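(* Let $(X,d)$ be a metric space and $f:X\to X$ a continuous map. If $(X,f)$ is thickly syndetically transitive, then it is strongly $\beta$-$n$-sensitive, i.e. it is $\beta$-$n$-sensitive for every $n\in\mathbb{N}$ with $n\geq2$ and every $\beta\in\mathbb{N}^n$.
   Context: $\mathbb{N}=\{1,2,3,\dots\}$. A set $A\subseteq\mathbb{N}$ is syndetic if there is a positive integer $M$ with $\{i,i+1,\dots,i+M\}\cap A\neq\emptyset$ for every $i\in\mathbb{N}$; it is thickly syndetic if for every $l\in\mathbb{N}$ the set $\{m\in\mathbb{N}: m+j\in A \text{ for } 0\leq j\leq l\}$ is syndetic. - $(X,f)$ is thickly syndetically transitive if for all nonempty open $U,V\subseteq X$ the set $\{k\in\mathbb{N}: f^k(U)\cap V\neq\emptyset\}$ is thickly syndetic. - For $\beta=(m_1,\dots,m_n)\in\mathbb{N}^n$, $(X,f)$ is $\beta$-$n$-sensitive if there is $\delta>0$ such that for every nonempty open $U\subseteq X$ there are $k\in\mathbb{N}$ and $x_1,\dots,x_n\in U$ with $\min_{1\leq i<j\leq n}d(f^{m_ik}(x_i),f^{m_jk}(x_j))>\delta$.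
   Formalization: The formal theorem additionally assumes that X is not a one-point space; for a one-point X the claim is false, since the system is thickly syndetically transitive but all distances are 0. *)

(* Defs.v *)
From mathcomp Require Import all_boot all_order all_algebra.
From mathcomp Require Import all_classical all_reals all_analysis.

Set Implicit Arguments.
Unset Strict Implicit.
Unset Printing Implicit Defensive.

Import Order.TTheory GRing.Theory Num.Theory.
Import numFieldNormedType.Exports.

Local Open Scope classical_set_scope.
Local Open Scope ring_scope.

(* The natural numbers start at 1: subsets of N are represented as sets of
   [nat], and every quantifier over N carries an explicit positivity
   condition. Whether 0 belongs to such a set is irrelevant to [syndetic] and
   [thickly_syndetic]. *)

Definition syndetic (A : set nat) : Prop :=
  exists M : nat, (0 < M)%N /\
    forall i : nat, (0 < i)%N ->
      [set j : nat | (i <= j <= i + M)%N] `&` A !=set0.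

Definition thickly_syndetic (A : set nat) : Prop :=
  forall l : nat, (0 < l)%N ->
    syndetic [set m : nat | (0 < m)%N /\
                forall j : nat, (j <= l)%N -> A (m + j)%N].

Definition thickly_syndetically_transitive (X : topologicalType)
    (f : X -> X) : Prop :=
  forall U V : set X, open U -> U !=set0 -> open V -> V !=set0 ->
    thickly_syndetic
      [set k : nat | (0 < k)%N /\ (iter k f @` U) `&` V !=set0].

(* For n >= 2, the minimum over the finite nonempty set of pairs i < j exceeds
   delta iff each of the distances does. *)
Definition beta_sensitive (R : realType) (X : metricType R) (n : nat)
    (beta : 'I_n -> nat) (f : X -> X) : Prop :=
  exists delta : R, 0 < delta /\
    forall U : set X, open U -> U !=set0 ->
      exists (k : nat) (x : 'I_n -> X),
        [/\ (0 < k)%N,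
            forall i, U (x i) &
            forall i j : 'I_n, (i < j)%N ->
              delta < mdist (iter (beta i * k) f (x i))
                            (iter (beta j * k) f (x j))].

Definition strongly_beta_sensitive (R : realType) (X : metricType R)
    (f : X -> X) : Prop :=
  forall (n : nat) (beta : 'I_n -> nat), (2 <= n)%N ->
    (forall i, (0 < beta i)%N) -> beta_sensitive beta f.

(* Main.v *)
Require Import Defs.
From mathcomp Require Import all_boot all_order all_algebra.
From mathcomp Require Import all_classical all_reals all_analysis.
From mathcomp Require Import finmap zify lra.

(** If [A] is thickly syndetic then so is [{k : m * k \in A}], and thickly
    syndetic sets are stable under finite intersection. Hence the hitting times
    of [U] with [n] given nonempty open sets [V_i] can be chosen of the form
    [m_i * k] with a common [k]. Such sets [V_i] at positive mutual distance
    exist because [X] is infinite: otherwise [X] is discrete, and the single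
    point [f^k(a)] would be equal to two distinct points for a common [k]. *)

Set Implicit Arguments.
Unset Strict Implicit.
Unset Printing Implicit Defensive.

Import Order.TTheory GRing.Theory Num.Theory.

Local Open Scope classical_set_scope.

Lemma thickly_syndeticT : thickly_syndetic setT.
Proof.
move=> l l0; exists 1%N; split=> // i i0.
by exists i; split; [rewrite /= leqnn leq_addr|].
Qed.

(** A run of [A] of length [l + MB] starts at some [p] within [MA] of [i]. A run of [B] of length
    [l] starts at some [q] within [MB] of [p], so it lies inside the run of [A]. *)
Lemma thickly_syndeticI (A B : set nat) :
  thickly_syndetic A -> thickly_syndetic B -> thickly_syndetic (A `&` B).
Proof.
move=> tsA tsB l l0; have [MB [MB0 hB]] := tsB _ l0.
have [|MA [MA0 hA]] := tsA (l + MB)%N; first by rewrite addn_gt0 l0.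
exists (MA + MB)%N; split=> [|i i0]; first by rewrite addn_gt0 MA0.
have [p [/= ip [p0 Ap]]] := hA _ i0.
have [q [/= pq [q0 Bq]]] := hB _ p0.
exists q; split=> /=; first lia.
split=> // j jl; split; last exact: Bq.
have -> : (q + j = p + (q - p + j))%N by lia.
apply: Ap; lia.
Qed.

Lemma thickly_syndetic_bigcap (I : choiceType) (s : seq I) (A : I -> set nat) :
  (forall i, thickly_syndetic (A i)) ->
  thickly_syndetic (\bigcap_(i in [set` s]) A i).
Proof.
move=> tsA; rewrite bigcap_seq; elim: s => [|i s IHs].
  by rewrite big_nil; exact: thickly_syndeticT.
by rewrite big_cons; exact: thickly_syndeticI.
Qed.

Lemma thickly_syndetic_preimage_muln (m : nat) (A : set nat) :
  (0 < m)%N -> thickly_syndetic A -> thickly_syndetic (muln m @^-1` A).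
Proof.
move=> m0 tsA l l0.
have [|M [M0 hA]] := tsA (m * l.+1)%N; first by rewrite muln_gt0 m0.
exists M.+1; split=> // i i0.
have [|p [/= ip [p0 Ap]]] := hA (m * i)%N; first by rewrite muln_gt0 m0.
have pE := divn_eq p m; have pm := ltn_pmod p m0.
(* Rounding [p] up to the next multiple of [m] costs at most [m]; the extra [m] in the run length
   [m * l.+1] pays for it. *)
exists (p %/ m).+1; split=> /=; first nia.
split=> // j jl.
have -> : (m * ((p %/ m).+1 + j) = p + (m * ((p %/ m).+1 + j) - p))%N by nia.
apply: Ap; nia.
Qed.

Lemma thickly_syndetic_gt0 (A : set nat) :
  thickly_syndetic A -> exists2 k, (0 < k)%N & A k.
Proof.
move=> /(_ 1%N erefl)[M [_ /(_ 1%N erefl)[k [_ [k0 Ak]]]]].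
by exists k => //; rewrite -[k]addn0; exact: Ak.
Qed.

Lemma transitive_infinite (R : realType) (X : metricType R) (f : X -> X)
    (a b : X) :
  a != b -> thickly_syndetically_transitive f -> infinite_set [set: X].
Proof.
move=> ab tr fX.
(* Finite sets are closed in a Hausdorff space, and every complement here is finite. *)
have op (A : set X) : open A.
  rewrite -[A]setCK; apply: closed_openC.
  have /hausdorff_accessible/accessible_finite_set_closed :=
    @metric_hausdorff R X.
  by apply; exact: sub_finite_set fX.
have ts c : thickly_syndetic
    [set k | (0 < k)%N /\ (iter k f @` [set a]) `&` [set c] !=set0].
  by apply: tr => //; [exists a|exists c].
have [k _ [[_ ha] [_ hb]]] :=
  thickly_syndetic_gt0 (thickly_syndeticI (ts a) (ts b)).
case: ha => _ [[_ -> <-] /= fa]; case: hb => _ [[_ -> <-] /= fb].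
by move: ab; rewrite -fa -fb eqxx.
Qed.

Local Open Scope ring_scope.

Lemma separated_points (R : realType) (X : metricType R) (n : nat) :
  infinite_set [set: X] ->
  exists (x : 'I_n -> X) (e : R),
    0 < e /\ forall i j, i != j -> e < mdist (x i) (x j).
Proof.
move=> /(infinite_set_fset n)[B _ nB].
pose x (i : 'I_n) : X := tnth (in_tuple (enum_fset B)) (widen_ord nB i).
have xI i j : i != j -> 0 < mdist (x i) (x j).
  rewrite mdist_gt0; apply: contra => /eqP.
  move=> /(tuple_uniqP (in_tuple (enum_fset B)) (fset_uniq B)).
  by move=> /(congr1 val) /= /val_inj ->.
(* The default [1] keeps [d] positive when there is no pair of distinct indices. Halving [d] below
   makes the bound strict. *)
pose d := \big[Num.min/1]_(p : 'I_n * 'I_n | p.1 != p.2) mdist (x p.1) (x p.2).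
have d0 : 0 < d by apply: lt_bigmin => // -[i j] /=; exact: xI.
exists x, (d / 2); split=> [|i j ij]; first lra.
suff : d <= mdist (x i) (x j) by lra.
exact: (bigmin_le_cond _ (j := (i, j))).
Qed.

Theorem theorem8 (R : realType) (X : metricType R) (f : X -> X)
    (X_not_singleton : ~ (exists x0 : X, forall x : X, x = x0))
    (f_cont : continuous f)
    (f_trans : thickly_syndetically_transitive f) :
  strongly_beta_sensitive f.
Proof.
move=> n beta _ beta0.
have [[a _]|X0] := pselect ([set: X] !=set0); last first.
  (* In the empty space there is no nonempty [U] to test. *)
  by exists 1; split=> // U _ [x _]; case: X0; exists x.
have [b ba] : exists b, b != a.
  apply: contrapT => nb; apply: X_not_singleton; exists a => x.
  by apply/eqP/negPn/negP => xa; apply: nb; exists x.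
have [x [e [e0 xe]]] := separated_points n (transitive_infinite ba f_trans).
have e4 : 0 < e / 4 by lra.
(* Points within [e / 4] of [x i] and [x j] are more than [e - 2 * (e / 4) = e / 2] apart, which
   exceeds [e / 4]. *)
exists (e / 4); split=> // U Uo U0.
pose V i := (ball (x i) (e / 4))°.
have V0 i : V i !=set0 by exists (x i); exact: nbhsx_ballx.
have ts i : thickly_syndetic (muln (beta i) @^-1`
    [set k | (0 < k)%N /\ (iter k f @` U) `&` V i !=set0]).
  apply: thickly_syndetic_preimage_muln => //; apply: f_trans => //.
  exact: open_interior.
(* A time [k] in the intersection over all indices makes [beta i * k] a hitting time of [V i] from
   [U] for every [i] at once. *)
have [k k0 hk] :=
  thickly_syndetic_gt0 (thickly_syndetic_bigcap (enum 'I_n) ts).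
have /choice[y hy] : forall i, exists y, U y /\ V i (iter (beta i * k) f y).
  move=> i; have [_ [_ [[y Uy <-] Vy]]] := hk i (mem_enum _ i).
  by exists y.
exists k, y; split=> // [i|i j ij]; first by have [] := hy i.
have [[_ /interior_subset Vi] [_ /interior_subset Vj]] := (hy i, hy j).
rewrite ballEmdist /= in Vi; rewrite ballEmdist /= in Vj.
have xij : e < mdist (x i) (x j) by apply: xe; rewrite neq_ltn ij.
set u := iter _ f (y i) in Vi *; set v := iter _ f (y j) in Vj *.
have := metric_triangle (x i) u (x j).
have := metric_triangle u v (x j).
rewrite (metric_sym v); lra.
Qed.
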